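(* Let $k$ and $r$ be integers with $1\le r\le k-2$. Then $$diss(K_{2k+r,k})\le 2\,\frac{rk+2r+k+1}{k(2r+1)}\binom{n-1}{k-1},\qquad\text{where } n=2k+r.$$
   Context: For positive integers $n,k$ with $n\ge 2k$, the Kneser graph $K_{n,k}$ has as vertices all $k$-element subsets of $[n]=\{1,\dots,n\}$, two of them being adjacent if and only if they are disjoint. A set $D$ of vertices of a graph $G$ is a dissociation set if the subgraph of $G$ induced by $D$ has maximum degree at most $1$. The dissociation number $diss(G)$ is the maximum cardinality of a dissociation set in $G$. *)

(* Defs.v *)
From mathcomp Require Import all_boot all_order all_algebra.

Set Implicit Arguments.
Unset Strict Implicit.
Unset Printing Implicit Defensive.

(* A finite simple graph is a symmetric irreflexive relation e : rel T on a
   finType T of vertices. *)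
Section Dissociation.
Variables (T : finType) (e : rel T).

Definition induced_degree (D : {set T}) (v : T) : nat := #|[set w in D | e v w]|.

Definition induced_max_degree (D : {set T}) : nat :=
  \max_(v in D) induced_degree D v.

Definition dissociation_set (D : {set T}) : bool := induced_max_degree D <= 1.

Definition diss : nat := \max_(D : {set T} | dissociation_set D) #|D|.

End Dissociation.

(* The ground set [n] is represented by 'I_n = {0, ..., n-1}. *)
Definition kneser_vertex (n k : nat) : finType := {A : {set 'I_n} | #|A| == k}.

Definition kneser (n k : nat) : rel (kneser_vertex n k) :=
  fun A B => [disjoint val A & val B].

Lemma kneser_sym n k : symmetric (@kneser n k).
Proof. by move=> A B; rewrite /kneser disjoint_sym. Qed.

(* Positivity of k is needed: the empty set is disjoint from itself. *)
Lemma kneser_irr n k : 0 < k -> irreflexive (@kneser n k).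
Proof.
move=> k_gt0 A; apply/negbTE; rewrite /kneser -setI_eq0 setIid -card_gt0.
by rewrite (eqP (valP A)).
Qed.

(* Main.v *)
Require Import Defs.
From mathcomp Require Import all_boot all_order all_algebra.
From mathcomp Require Import all_fingroup.
From mathcomp Require Import zify.

Set Implicit Arguments.
Unset Strict Implicit.
Unset Printing Implicit Defensive.

Import Order.TTheory GRing.Theory Num.Theory.
Local Open Scope ring_scope.

(** The proof follows Katona's cycle method.  Place [n] on a circle by a
    permutation and look only at the n arcs of k consecutive points.  If at
    most m arcs of every circular arrangement belong to a family of k-sets,
    then averaging over all arrangements shows that the family contains at
    most a fraction m / n of all k-sets ([katona_averaging]).

    Index the arcs by their first points, in Z/n with n = 2k + r.  The arc at v
    is disjoint from the arcs at v + k, ..., v + k + r, so a dissociation set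
    traces on the circle a set S in which each v in S has at most one element
    of its window {v + k, ..., v + k + r} in S.  The claim is
    |S| (2r + 1) <= 2 (rk + 2r + k + 1) ([arc_bound]), and multiplying it by
    'C(n, k) / n gives the theorem.

    If no window of a point of S meets S, then |S| <= k by the classical pairing
    of x + i with x + k + r + i ([arc_bound_independent]).  Otherwise x and
    y = x + k + u are both in S for some u <= r, and the pairs (w, e) with
    e <= r and w + k + e outside S are counted ([arc_bound_edge]).  There are
    (r + 1)(n - |S|) of them, each w in S accounts for at least r, and the
    windows of x and y, which miss S except for y and x themselves, account for
    at least r (r + 1) together: the window of w = x + k + e is the window of y
    translated by e - u, so all but |e - u| + 1 of its points miss S.  This
    last gain is what makes the count sharp enough when r is large, where
    double counting over S and its complement alone does not suffice. *)

(** * Averaging over circular arrangements *)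

Lemma exists_perm_imset (T : finType) (A B : {set T}) :
  #|A| = #|B| -> exists s : {perm T}, s @: A = B.
Proof.
move=> eqAB.
have eqC : #|~: A| = #|~: B| by have := cardsC A; have := cardsC B; lia.
pose sa := enum A ++ enum (~: A); pose sb := enum B ++ enum (~: B).
have enumU (C : {set T}) : uniq (enum C ++ enum (~: C)).
  rewrite cat_uniq !enum_uniq andbT /=; apply/hasPn => x.
  by rewrite !mem_enum inE.
have mem_all (C : {set T}) x : x \in enum C ++ enum (~: C).
  by rewrite mem_cat !mem_enum inE orbN.
have eqsz : size sa = size sb by rewrite !size_cat -!cardE eqAB eqC.
pose f x := nth x sb (index x sa).
have f_inj : injective f.
  move=> x y; rewrite /f (set_nth_default y) -?eqsz ?index_mem ?mem_all //.
  move/eqP; rewrite nth_uniq -?eqsz ?index_mem ?mem_all ?enumU // => /eqP.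
  by move/(congr1 (nth x sa)); rewrite !nth_index ?mem_all.
exists (perm f_inj); apply/eqP; rewrite eqEcard card_imset; last exact: perm_inj.
rewrite eqAB leqnn andbT; apply/subsetP => _ /imsetP[x xA ->].
have ltx : (index x (enum A) < size (enum B))%N.
  by rewrite -cardE -eqAB cardE index_mem mem_enum.
by rewrite permE /f /sa index_cat mem_enum xA /sb nth_cat ltx -mem_enum mem_nth.
Qed.

(** Composing with a permutation that sends C to B shows that the number of s
    with s @: A = C is the same for all C of the cardinality of A; these classes
    partition the permutations. *)
Lemma card_perm_imset (T : finType) (A B : {set T}) : #|A| = #|B| ->
  (#|[set s : {perm T} | s @: A == B]| * 'C(#|T|, #|A|) = #|{perm T}|)%N.
Proof.
move=> eqAB; pose N (C : {set T}) := #|[set s : {perm T} | s @: A == C]|.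
have N_const (C : {set T}) : #|C| = #|A| -> N C = N B.
  move=> cC; have [s sBC] : exists s : {perm T}, s @: C = B.
    by apply: exists_perm_imset; rewrite cC.
  rewrite /N -(card_imset _ (mulIg s)); apply: eq_card => t.
  rewrite inE; apply/imsetP/eqP => [[t0 /[!inE] /eqP t0A ->]|tAB].
    by rewrite -sBC -t0A -imset_comp; apply: eq_imset => x; rewrite /= permM.
  exists (t * s^-1)%g; last by rewrite mulgKV.
  rewrite inE; apply/eqP/(imset_inj (@perm_inj _ s)); rewrite sBC -tAB -imset_comp.
  by apply: eq_imset => x; rewrite /= permM permKV.
rewrite -card_draws -[RHS]sum1_card mulnC.
rewrite (partition_big (fun s : {perm T} => s @: A)
           (fun C => C \in [set C : {set T} | #|C| == #|A|])) /=; last first.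
  by move=> s _; rewrite inE card_imset //; apply: perm_inj.
rewrite -sum_nat_const; apply: eq_bigr => C; rewrite inE => /eqP cC.
by rewrite sum1dep_card -/(N B) -(N_const _ cC).
Qed.

(** Count the pairs (s, i) with s @: J i in F, first for fixed s and then, by
    [card_perm_imset], for fixed i and fixed image. *)
Lemma katona_averaging (T I : finType) (k a M : nat) (F : {set {set T}})
    (J : I -> {set T}) :
  (forall A, A \in F -> #|A| = k) -> (forall i, #|J i| = k) ->
  (forall s : {perm T}, #|[set i | s @: J i \in F]| * a <= M)%N ->
  (#|F| * #|I| * a <= M * 'C(#|T|, k))%N.
Proof.
move=> cF cJ bound.
have perm_gt0 : (0 < #|{perm T}|)%N by apply/card_gt0P; exists 1%g.
have cardF (s : {perm T}) :
    #|[set i | s @: J i \in F]| = (\sum_i (if s @: J i \in F then 1 else 0))%N.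
  by rewrite -sum1_card big_mkcond; apply: eq_bigr => i _; rewrite inE.
have count : ((\sum_(s : {perm T}) #|[set i | s @: J i \in F]|) * 'C(#|T|, k)
              = #|F| * #|I| * #|{perm T}|)%N.
  rewrite (eq_bigr _ (fun s _ => cardF s)) exchange_big big_distrl /=.
  rewrite -mulnA mulnCA -sum_nat_const /=.
  apply: eq_bigr => i _; rewrite -sum_nat_const -big_mkcond /=.
  rewrite (partition_big (fun s : {perm T} => s @: J i) (fun A => A \in F)) //=.
  rewrite big_distrl; apply: eq_bigr => A AF /=.
  have eqJA : #|J i| = #|A| by rewrite cJ cF.
  rewrite -(card_perm_imset eqJA) cJ; congr (_ * _)%N; rewrite -sum1_card.
  by apply: eq_bigl => s; rewrite inE; case: eqP => [->|]; rewrite ?AF ?andbF.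
rewrite -(leq_pmul2r perm_gt0) mulnAC -count mulnAC [leqRHS]mulnAC leq_mul2r.
apply/orP; right; rewrite big_distrl /= mulnC -sum_nat_const; exact: leq_sum.
Qed.

(** * Sets of arcs on a circle of 2k + r points *)

Lemma sum_ltn_leq (m a : nat) : (\sum_(i < m) (i < a) <= a)%N.
Proof.
elim: m => [|m IH]; first by rewrite big_ord0.
rewrite big_ord_recr /=; have [lt_ma|] := ltnP m a; last by rewrite addn0.
apply: leq_trans lt_ma; rewrite addn1 ltnS.
apply: (@leq_trans (\sum_(i < m) 1)); first by apply: leq_sum => i _; case: ltnP.
by rewrite sum_nat_const card_ord muln1.
Qed.

Lemma sum_rev_ltn_leq (m a : nat) : (\sum_(i < m) (rev_ord i < a) <= a)%N.
Proof.
rewrite (reindex_inj rev_ord_inj) (eq_bigr (fun i : 'I_m => (i < a) : nat)).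
  exact: sum_ltn_leq.
by move=> i _; rewrite rev_ordK.
Qed.

Section Circle.
Variables (p k r : nat).
Hypothesis n_def : p.+2 = (2 * k + r)%N.
Hypothesis lt_rk : (r < k)%N.
Notation V := 'I_p.+2.
Implicit Types (x y v w : V) (S : {set V}).

Lemma natV0 : (2 * k + r)%:R = 0 :> V.
Proof. by rewrite -n_def; exact: (@pchar_Zp p.+2). Qed.

Lemma natV_eq0 m : (0 < m < 2 * k + r)%N -> (m%:R == 0 :> V) = false.
Proof.
move=> /andP[m0 mn]; apply/eqP => /(congr1 (@nat_of_ord _)).
by rewrite (@Zp_nat p) /= modn_small; lia.
Qed.

(** The trace on Z/n of a dissociation set: among the arcs disjoint from the arc
    at a point of S, at most one starts in S. *)
Definition dissociated S := forall v e e', v \in S -> (e <= r)%N -> (e' <= r)%N ->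
  v + (k + e)%:R \in S -> v + (k + e')%:R \in S -> e = e'.

(** The contribution of v to the double count of pairs (v, e) with v + k + e
    outside S. *)
Definition gaps S v : nat := (\sum_(e < r.+1) ((v + (k + e)%:R)%R \notin S))%N.

Lemma sum_gaps S : (\sum_v gaps S v + r.+1 * #|S| = r.+1 * (2 * k + r))%N.
Proof.
rewrite -n_def -[X in (_ = _ * X)%N](card_ord p.+2) -(cardsC S) mulnDr addnC; congr (_ + _)%N.
rewrite exchange_big /= -[X in (_ = X * _)%N](card_ord r.+1) -sum_nat_const.
apply: eq_bigr => e _; rewrite -sum1_card [RHS]big_mkcond /=.
rewrite [RHS](reindex_inj (addIr (k + e)%:R)) /=.
by apply: eq_bigr => w _; rewrite inE; case: (_ \in _).
Qed.

Lemma gapsE S v :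
  (gaps S v + \sum_(e < r.+1) ((v + (k + e)%:R)%R \in S) = r.+1)%N.
Proof.
rewrite -big_split /= -[RHS]card_ord -sum1_card.
by apply: eq_bigr => e _; case: (_ \in _).
Qed.

Lemma gaps_in S v : dissociated S -> v \in S -> (r <= gaps S v)%N.
Proof.
move=> dS vS; have := gapsE S v.
suff : (\sum_(e < r.+1) ((v + (k + e)%:R)%R \in S) <= 1)%N by lia.
have [e /= eS|none] := pickP (fun e : 'I_r.+1 => v + (k + e)%:R \in S); last first.
  by rewrite big1 // => e _; rewrite none.
rewrite (bigD1 e) //= eS big1 // => e' /negP ne.
case e'S: (_ \in S) => //; case: ne; apply/eqP/val_inj.
by apply: (dS v e' e vS _ _ e'S eS); rewrite -ltnS.
Qed.

(** The translate by e - u of the window of y = x + k + u meets that window in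
    all but |e - u| points, and the only point of S in it is x = y + k + (r - u).
    One of the two truncated differences u - e and e - u vanishes, so that their
    sum is |e - u|. *)
Lemma gaps_window S x u (e : nat) : dissociated S -> (u <= r)%N -> (e <= r)%N ->
  x \in S -> x + (k + u)%:R \in S ->
  (r <= gaps S (x + (k + e)%:R)%R + (u - e) + (e - u))%N.
Proof.
move=> dS ur er xS yS; have := gapsE S (x + (k + e)%:R).
suff : (\sum_(e' < r.+1) ((x + (k + e)%:R + (k + e')%:R)%R \in S)
        <= (u - e) + (e - u) + 1)%N by lia.
apply: (@leq_trans (\sum_(e' < r.+1) ((e' < u - e) + (rev_ord e' < e - u)
                     + (e' == r - e :> nat)))).
  (* The three terms bound the points before the window of y, the points after
     it, and the single point x. *)
  apply: leq_sum => e' _; case wS: (_ \in S) => //.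
  have [//|out1] := ltnP e' (u - e); have [//|out2] := ltnP (rev_ord e') (e - u).
  have e'r : (e' <= r)%N by rewrite -ltnS.
  rewrite /= in out2.
  suff -> : nat_of_ord e' = (r - e)%N by rewrite eqxx.
  suff : (e + e' - u = r - u)%N by lia.
  apply: (dS (x + (k + u)%:R)) => //; try lia.
    suff -> : x + (k + u)%:R + (k + (e + e' - u))%:R = x + (k + e)%:R + (k + e')%:R by [].
    by rewrite -!addrA -!natrD; congr (_ + _%:R); lia.
  suff -> : x + (k + u)%:R + (k + (r - u))%:R = x by [].
  rewrite -addrA -natrD (_ : _ + _ = 2 * k + r)%N; last lia.
  by rewrite natV0 addr0.
rewrite !big_split /= leq_add // ?leq_add ?sum_ltn_leq //.
  exact: sum_rev_ltn_leq.
rewrite (bigD1 (inord (r - e))) //= inordK ?eqxx; last by lia.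
rewrite big1 // => i /negP ne; case: eqP => // ie; case: ne.
by apply/eqP/val_inj; rewrite /= inordK //; lia.
Qed.

Lemma natV_inj x (a b : nat) : (a <= b)%N -> (b < a + (2 * k + r))%N ->
  x + a%:R = x + b%:R :> V -> a = b.
Proof.
move=> ab bn /addrI ab_eq; apply/eqP; rewrite eqn_leq ab leqNgt; apply/negP => lt_ab.
have /negP[] := natV_eq0 (m := b - a) ltac:(lia).
by rewrite natrB // ab_eq subrr.
Qed.

Definition window x : {set V} := [set x + (k + e)%:R | e : 'I_r.+1].

Lemma sum_window x (F : V -> nat) :
  (\sum_(w in window x) F w = \sum_(e < r.+1) F (x + (k + e)%:R)%R)%N.
Proof.
rewrite big_imset //= => e e' _ _ eq_w; apply/val_inj/eqP; rewrite /= -(eqn_add2l k).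
have [le|le] := leqP e e'; first by apply/eqP/(@natV_inj x) => //; have := ltn_ord e'; lia.
by rewrite eq_sym; apply/eqP/(@natV_inj x) => //; have := ltn_ord e; lia.
Qed.

(** Adjacency is symmetric because k + u and k + (r - u) add up to n, so
    [gaps_window] applies both to x with shift u and to y with shift r - u.  For
    each e the two losses |e - u| and |e - (r - u)| add up to at most r, which
    leaves at least 2r - r = r gaps for the points x + k + e and y + k + e
    together. *)
Lemma arc_bound_edge S x u : dissociated S -> (u <= r)%N -> x \in S ->
  x + (k + u)%:R \in S -> (#|S| * (2 * r + 1) <= 2 * (r + 1) * k + 2 * r)%N.
Proof.
move=> dS ur xS; set y := x + _ => yS.
have xE : x = y + (k + (r - u))%:R.
  rewrite /y -addrA -natrD (_ : _ + _ = 2 * k + r)%N; last lia.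
  by rewrite natV0 addr0.
have disjW : [disjoint window x & window y].
  rewrite -setI_eq0; apply/eqP/setP => w; rewrite !inE; apply/negP.
  move=> /andP[/imsetP[e _ ->] /imsetP[e' _]].
  rewrite /y -addrA -natrD => eq_w; have := ltn_ord e; have := ltn_ord e' => He' He.
  by have := natV_inj _ _ eq_w; lia.
have WS z a : z \in S -> (a <= r)%N -> z + (k + a)%:R \in S ->
    forall w, w \in window z -> w \in S -> w = z + (k + a)%:R.
  move=> zS ar aS _ /imsetP[e _ ->] eS; congr (_ + (_ + _)%:R).
  by apply: (dS z) => //; rewrite -ltnS.
have disjS : [disjoint S :\ x :\ y & [predU window x & window y]].
  apply/pred0P => w; rewrite /= !inE; apply/negP.
  move=> /andP[/and3P[/eqP wy /eqP wx wS] /orP[wW|wW]].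
    by apply: wy; rewrite (WS x u _ _ _ w).
  by apply: wx; rewrite [RHS]xE (WS y (r - u)%N _ _ _ w) -?xE // leq_subr.
have neq_yx : y != x.
  rewrite -subr_eq0 /y [x + _]addrC addrK; apply/negbT/natV_eq0; lia.
have cardS : #|S| = (#|S :\ x :\ y| + 2)%N.
  by rewrite (cardsD1 x) xS (cardsD1 y (S :\ x)) !inE neq_yx yS addnC addn1 addn2.
have total := sum_gaps S.
have split_sum : (\sum_(w in S :\ x :\ y) gaps S w +
    (\sum_(w in window x) gaps S w + \sum_(w in window y) gaps S w)
    <= \sum_w gaps S w)%N.
  rewrite -bigU // -bigU //=.
  rewrite [leqRHS](bigID (mem [predU S :\ x :\ y & [predU window x & window y]])) /=.
  exact: leq_addr.
have inS : (#|S :\ x :\ y| * r <= \sum_(w in S :\ x :\ y) gaps S w)%N.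
  rewrite -sum_nat_const; apply: leq_sum => w; rewrite !inE => /and3P[_ _ wS].
  exact: gaps_in.
have inW : (r.+1 * r <= \sum_(w in window x) gaps S w + \sum_(w in window y) gaps S w)%N.
  rewrite !sum_window -big_split /= -{1}(card_ord r.+1) -sum_nat_const.
  apply: leq_sum => e _; have er : (e <= r)%N by rewrite -ltnS.
  have := gaps_window dS ur er xS yS.
  have := @gaps_window S y (r - u)%N e dS (leq_subr _ _) er yS; rewrite -xE => /(_ xS).
  lia.
nia.
Qed.

(** All of S lies in x + [0, k) and x + [k + r, n), and x + i is adjacent to
    x + (k + r + i), so each i < k contributes at most one point. *)
Lemma arc_bound_independent S x : x \in S ->
  (forall v e, v \in S -> (e <= r)%N -> v + (k + e)%:R \notin S) -> (#|S| <= k)%N.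
Proof.
move=> xS indep.
have -> : (#|S| = \sum_(m < (k + r) + k) ((x + m%:R)%R \in S))%N.
  have -> : (k + r + k = p.+2)%N by lia.
  rewrite -sum1_card big_mkcond /= (reindex_inj (addrI x)) /=.
  apply: eq_bigr => m _; have -> : (m : nat)%:R = m :> V by exact: (@natr_Zp p m).
  by case: (_ \in _).
rewrite !big_split_ord /= [X in (_ + X + _)%N]big1 => [|i _]; last first.
  by rewrite (negbTE (indep x i xS (ltnW (ltn_ord i)))).
rewrite addn0 -big_split /= -[leqRHS]card_ord -sum1_card; apply: leq_sum => i _.
case iS: (_ \in S); last by case: (_ \in _).
rewrite addnC.
have := indep _ r iS (leqnn _).
by rewrite -addrA -natrD addnC => /negbTE ->.
Qed.

Lemma arc_bound S : dissociated S ->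
  (#|S| * (2 * r + 1) <= 2 * (r * k + 2 * r + k + 1))%N.
Proof.
move=> dS.
have [/existsP[x /andP[xS /existsP[e yS]]]|none] :=
  boolP [exists x in S, [exists e : 'I_r.+1, x + (k + e)%:R \in S]].
  have := arc_bound_edge dS (ltn_ord e) xS yS; lia.
have [->|[x xS]] := set_0Vmem S; first by rewrite cards0.
suff : (#|S| <= k)%N by nia.
apply: (arc_bound_independent xS) => v e vS er.
apply: contra none => eS; apply/existsP; exists v; rewrite vS /=; apply/existsP.
by exists (inord e); rewrite inordK.
Qed.

Definition arc x : {set V} := [set x + (j : nat)%:R | j : 'I_k].

Lemma card_arc x : #|arc x| = k.
Proof.
rewrite card_imset ?card_ord // => i j eq_ij; apply/val_inj/eqP => /=.
have [le|le] := leqP i j; first by apply/eqP/(@natV_inj x) => //; have := ltn_ord j; lia.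
by rewrite eq_sym; apply/eqP/(@natV_inj x) => //; have := ltn_ord i; lia.
Qed.

Lemma arc_disjoint x e : (e <= r)%N -> [disjoint arc x & arc (x + (k + e)%:R)].
Proof.
move=> er; rewrite -setI_eq0; apply/eqP/setP => w; rewrite !inE; apply/negP.
move=> /andP[/imsetP[i _ ->] /imsetP[j _]].
rewrite -addrA -natrD => eq_w; have := ltn_ord i; have := ltn_ord j => Hj Hi.
by have := natV_inj _ _ eq_w; lia.
Qed.

Lemma arc_neq x e e' : (e < e' <= r)%N ->
  arc (x + (k + e)%:R) != arc (x + (k + e')%:R).
Proof.
move=> /andP[lt_ee' e'r]; have k0 : (0 < k)%N by lia.
apply/eqP/setP => /(_ (x + (k + e)%:R)).
have -> : x + (k + e)%:R \in arc (x + (k + e)%:R).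
  by apply/imsetP; exists (Ordinal k0); rewrite //= addr0.
move/esym/imsetP => [j _]; rewrite -addrA -natrD => eq_w.
by have := ltn_ord j; have := natV_inj _ _ eq_w; lia.
Qed.

End Circle.

(** * From the circle to the Kneser graph *)

Lemma dissociation_set_neighbor_uniq (T : finType) (e : rel T) (D : {set T}) (v a b : T) :
  dissociation_set e D -> v \in D -> a \in D -> b \in D -> e v a -> e v b -> a = b.
Proof.
move=> /bigmax_leqP dD vD aD bD va vb; apply/eqP; rewrite -[_ == _]negbK.
apply/negP => neq_ab; have := dD v vD; rewrite leqNgt => /negP; apply.
have eq2 : #|[set a; b]| = 2%N by rewrite cards2 neq_ab.
rewrite -[X in (X <= _)%N]eq2.
by apply/subset_leq_card/subsetP => w; rewrite !inE => /orP[] /eqP ->; rewrite ?aD ?bD.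
Qed.

Lemma kneser_dissociation_bound (k r n : nat) (D : {set kneser_vertex n k}) :
  (r < k)%N -> (1 < n)%N -> n = (2 * k + r)%N -> dissociation_set (@kneser n k) D ->
  (#|D| * n * (2 * r + 1) <= 2 * (r * k + 2 * r + k + 1) * 'C(n, k))%N.
Proof.
(* The form p.+2 of n gives 'I_n its ring structure. *)
case: n D => [|[|p]] // D rk _ n_def dD.
rewrite -(card_imset _ val_inj).
suff : (#|val @: D| * #|'I_p.+2| * (2 * r + 1)
        <= 2 * (r * k + 2 * r + k + 1) * 'C(#|'I_p.+2|, k))%N by rewrite !card_ord.
apply: (katona_averaging (J := fun i => arc k i)) => [A|i|s].
- by case/imsetP => v _ ->; apply/eqP/(valP v).
- exact: (card_arc n_def rk).
apply: (arc_bound n_def rk) => v e e'; rewrite !inE => /imsetP[V0 V0D eqV0] er e'r.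
move=> /imsetP[V1 V1D eqV1] /imsetP[V2 V2D eqV2].
have disj W f : val W = s @: arc k (v + (k + f)%:R) -> (f <= r)%N -> kneser V0 W.
  move=> eqW fr; rewrite /kneser -eqV0 eqW -setI_eq0 -imsetI; last first.
    by move=> ? ? _ _; apply: perm_inj.
  by have := arc_disjoint n_def rk v fr; rewrite -setI_eq0 => /eqP ->; rewrite imset0.
have eq12 : V1 = V2.
  by apply: (dissociation_set_neighbor_uniq dD V0D) => //; [apply: disj er|apply: disj e'r].
have eq_arc : arc k (v + (k + e)%:R) = arc k (v + (k + e')%:R).
  by apply: (imset_inj (@perm_inj _ s)); rewrite eqV1 eqV2 eq12.
case: (ltngtP e e') => // lt_ee'.
  by have := @arc_neq _ _ _ n_def rk v e e'; rewrite lt_ee' e'r eq_arc eqxx => /(_ isT).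
by have := @arc_neq _ _ _ n_def rk v e' e; rewrite lt_ee' er eq_arc eqxx => /(_ isT).
Qed.

Theorem mainTheorem5 (k r n : nat) (hr1 : (1 <= r)%N) (hrk : (r <= k - 2)%N)
    (hn : n = (2 * k + r)%N) :
  (diss (@kneser n k))%:R <=
    2 * ((r * k + 2 * r + k + 1)%:R / (k * (2 * r + 1))%:R)
      * 'C(n - 1, k - 1)%:R :> rat.
Proof.
have k0 : (0 < k)%N by lia.
have n0 : (0 < n)%N by lia.
rewrite mulrA mulrAC ler_pdivlMr ?ltr0n; last by nia.
rewrite -!natrM ler_nat.
have [D dD ->] : {D : {set kneser_vertex n k} | dissociation_set (@kneser n k) D &
                       diss (@kneser n k) = #|D|}.
  apply: eq_bigmax_cond; apply/card_gt0P; exists set0.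
  by apply/bigmax_leqP => v; rewrite inE.
have := @kneser_dissociation_bound k r n D ltac:(lia) ltac:(lia) hn dD.
have := mul_bin_diag n k.-1; rewrite !prednK // -!subn1 => bin_eq bound.
have : (n * (#|D| * (k * (2 * r + 1)))
        <= n * (2 * (r * k + 2 * r + k + 1) * 'C(n - 1, k - 1)))%N.
  rewrite [leqRHS]mulnCA bin_eq; nia.
by rewrite leq_pmul2l.
Qed.
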